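(* There is a sequence of real numbers $(\delta_k)_{k\ge1}$ with $\delta_k\to0$ as $k\to\infty$ such that, for all $k$, $$\log\epsilon_k\le 2^k\log(C+\delta_k),$$ where $\epsilon_k$ and $C$ are as defined in the context. (Informally: $\log\epsilon_k\le 2^k\log(C+o(1))$.)
   Context: For a positive integer $n$, $\Phi_n(x)=\prod_{1\le j\le n,\ (j,n)=1}(x-e^{2\pi i j/n})=\sum_{m=0}^{\varphi(n)}a_n(m)x^m$ is the $n$-th cyclotomic polynomial, $A_n=\max_m|a_n(m)|$ and $S_n=\sum_{m=0}^{\varphi(n)}|a_n(m)|$. For distinct odd primes $p_1<p_2<\dots<p_k$ put $M_k=M_k(p_1,\dots,p_k)=\prod_{i=1}^{k-2}p_i^{2^{k-i-1}-1}$ (an empty product is $1$). $\epsilon_k$ denotes the smallest positive real number such that $A_{p_1\cdots p_k}\le\epsilon_kM_k$ for all odd primes $p_1<\dots<p_k$. Let $$d=\sup_{p<q<r\ \text{odd primes}}\frac{S_{pqr}}{p^2qr},\qquad \rho=\prod_{i=0}^{\infty}\Big(\frac{2i+5}{2i+6}\Big)^{1/2^i},\qquad C=\Big(\tfrac34\,\epsilon_3^{3/2}\,d\,\rho^{1/4}\Big)^{1/32}.$$ *)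

(* Defs.v *)
From mathcomp Require Import all_boot all_order all_algebra all_field.
Set Implicit Arguments. Unset Strict Implicit. Unset Printing Implicit Defensive.

(* |a_n(m)| as a natural number; 'Phi_n : {poly int} is MathComp's n-th
   cyclotomic polynomial, of size phi(n)+1, so m ranges over 0..phi(n). *)
Definition cyc_abs_coef (n m : nat) : nat := absz (('Phi_n)`_m)%R.

Definition cycA (n : nat) : nat :=
  \max_(m < size ('Phi_n)) cyc_abs_coef n m.

Definition cycS (n : nat) : nat :=
  \sum_(m < size ('Phi_n)) cyc_abs_coef n m.

(* p_1 < p_2 < ... < p_k are odd primes (p is 1-indexed; only p 1..p k matter) *)
Definition odd_primes_incr (k : nat) (p : nat -> nat) : Prop :=
  (forall i, 1 <= i <= k -> prime (p i) && odd (p i)) /\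
  (forall i, 1 <= i < k -> p i < p i.+1).

Definition prod_primes (k : nat) (p : nat -> nat) : nat :=
  \prod_(1 <= i < k.+1) p i.

Definition Mk (k : nat) (p : nat -> nat) : nat :=
  \prod_(1 <= i < k.-1) p i ^ (2 ^ (k - i - 1) - 1).

From Stdlib Require Import Reals.
Open Scope R_scope.

Definition eps_bound_prop (k : nat) (e : R) : Prop :=
  forall p : nat -> nat, odd_primes_incr k p ->
    INR (cycA (prod_primes k p)) <= e * INR (Mk k p).

Definition is_eps (k : nat) (e : R) : Prop :=
  0 < e /\ eps_bound_prop k e /\
  (forall e' : R, 0 < e' -> eps_bound_prop k e' -> e <= e').

Definition d_set (x : R) : Prop :=
  exists p q r : nat,
    prime p /\ odd p /\ prime q /\ odd q /\ prime r /\ odd r /\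
    (p < q)%nat /\ (q < r)%nat /\
    x = INR (cycS (p * q * r)) / INR (p ^ 2 * q * r).

Definition is_d (d : R) : Prop := is_lub d_set d.

Fixpoint rho_partial (n : nat) : R :=
  match n with
  | O => Rpower (5 / 6) (/ 2 ^ 0)
  | S m => rho_partial m *
           Rpower ((2 * INR (S m) + 5) / (2 * INR (S m) + 6)) (/ 2 ^ (S m))
  end.

Definition is_rho (rho : R) : Prop := Un_cv rho_partial rho.

Definition Cconst (eps3 d rho : R) : R :=
  Rpower (3 / 4 * Rpower eps3 (3 / 2) * d * Rpower rho (1 / 4)) (1 / 32).

(* Main.v *)
(** Write S_j for the sum of the absolute values of the coefficients of the
    cyclotomic polynomial of p_1...p_j.  Iterating Phi_m(X^p) = Phi_mp(X) Phi_m(X)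
    gives, for n = p_1...p_k,
      Phi_n * prod_(i<=k) (1 - X^(n/p_i))
        = (1 - X^n) * prod_(2<=i<=k) (1 - X^(n/(p_1 p_i))) * G,
    where G is a product of polynomials Phi_(p_1...p_j)(X^e), j <= k-2, the index j
    occurring k-1-j times.  Hence, up to degree phi(n)/2, Phi_n agrees with U V G,
    where U is a product of k-1 binomials and V is the sum of the X^(sum a_i n/p_i)
    with 0 <= a_i < p_i/2.  The coefficients of V are 0 or 1 by the Chinese
    remainder theorem, and as V is palindromic of degree > phi(n) when k >= 4, at
    most half of its terms have degree <= phi(n)/2.  With
    Q_k = prod_(j<=k-2) S_j^(k-1-j) this yields
      A_n <= 2^(k-1) Q_k   and   S_n <= 1/2 prod (p_i + 1) Q_k   (k >= 4).
    Feeding S_p <= p, S_pq <= pq/2, S_pqr <= d p^2 q r into this recursion bounds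
    eps_k by 2^(k-1) (25 d / 81)^(2^(k-5)) for k >= 5.  Finally 25 d / 81 <= C^32,
    because eps_3 >= 2/3 (the coefficient of X^7 in Phi_105 is -2) and
    rho >= (5/6)^2. *)

Require Import Defs.

Module CyclotomicBounds.

From mathcomp Require Import all_boot all_algebra all_field.
From mathcomp Require Import zify ring.
Set Implicit Arguments. Unset Strict Implicit. Unset Printing Implicit Defensive.
Import GRing.Theory.
Local Open Scope ring_scope.

(** * Cyclotomic polynomials of squarefree index *)

Lemma prod_primesS k p : prod_primes k.+1 p = (prod_primes k p * p k.+1)%N.
Proof. by rewrite /prod_primes big_nat_recr. Qed.

Lemma divisors_mul_prime (m q : nat) : (0 < m)%N -> prime q -> ~~ (q %| m)%N ->
  perm_eq (divisors (m * q)) (divisors m ++ [seq (d * q)%N | d <- divisors m]).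
Proof.
move=> m0 pq qm; have q0 := prime_gt0 pq.
have mq0 : (0 < m * q)%N by rewrite muln_gt0 m0.
apply: uniq_perm; first exact: divisors_uniq.
  rewrite cat_uniq divisors_uniq /= map_inj_uniq ?divisors_uniq ?andbT.
    apply/hasPn => x /mapP[d _ ->]; rewrite /= -dvdn_divisors //.
    by apply: contra qm; apply: dvdn_trans; apply: dvdn_mull.
  by move=> x y /eqP; rewrite eqn_pmul2r // => /eqP.
move=> x; rewrite -dvdn_divisors // mem_cat -dvdn_divisors //.
apply/idP/orP => [xd|[xm|/mapP[d]]]; last 2 first.
- exact: dvdn_mulr.
- by rewrite -dvdn_divisors // => dm ->; apply: dvdn_mul.
have [qx|qx] := boolP (q %| x)%N.
  right; apply/mapP; exists (x %/ q)%N; last by rewrite divnK.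
  by rewrite -dvdn_divisors // -(dvdn_pmul2r q0) divnK.
by left; rewrite -(@Gauss_dvdl x m q) // coprime_sym prime_coprime.
Qed.

(** Strong induction on [m]: X^(mq) - 1 is factored over the divisors of [m * q], and also as X^m -
    1 composed with X^q. By induction the factors for proper divisors d of [m] agree; cancelling
    them leaves d = m. *)
Lemma Cyclotomic_comp_prime (m q : nat) :
  (0 < m)%N -> prime q -> ~~ (q %| m)%N ->
  'Phi_m \Po 'X^q = 'Phi_(m * q) * 'Phi_m.
Proof.
elim/ltn_ind: m => m IHm m0 pq qm; have q0 := prime_gt0 pq.
have nz n : 'Phi_n != 0 :> {poly int} by apply: monic_neq0; apply: Cyclotomic_monic.
have := prod_Cyclotomic (n := (m * q)%N); rewrite muln_gt0 m0 q0 => /(_ isT).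
have -> : 'X^(m * q) - 1 = ('X^m - 1) \Po 'X^q :> {poly int}.
  by rewrite comp_polyB comp_Xn_poly -exprM mulnC comp_polyC.
rewrite -(prod_Cyclotomic m0) (perm_big _ (divisors_mul_prime m0 pq qm)) big_cat.
rewrite big_map /= -big_split /= rmorph_prod.
have mD := divisors_id m0.
rewrite !(bigD1_seq m) ?divisors_uniq //=.
have -> : \prod_(d <- divisors m | d != m) ('Phi_d * 'Phi_(d * q)) =
          \prod_(d <- divisors m | d != m) ('Phi_d \Po 'X^q) :> {poly int}.
  rewrite big_seq_cond [RHS]big_seq_cond; apply: eq_bigr => d.
  rewrite -dvdn_divisors // => /andP[dm ne].
  rewrite IHm 1?mulrC ?(dvdn_gt0 m0 dm) //.
    by rewrite ltn_neqAle ne dvdn_leq.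
  by apply: contra qm => /dvdn_trans; apply.
have nzc P : P != 0 -> P \Po 'X^q != 0 :> {poly int}.
  by move=> P0; rewrite comp_poly_eq0 // size_polyXn.
have nzP : \prod_(d <- divisors m | d != m) ('Phi_d \Po 'X^q) != 0 :> {poly int}.
  by rewrite prodf_seq_neq0; apply/allP => d _; apply/implyP => _; exact/nzc.
by move=> e; rewrite [RHS]mulrC; apply/esym/(mulIf nzP).
Qed.

Lemma Cyclotomic_1 : 'Phi_1 = 'X - 1.
Proof. by have := prod_Cyclotomic (ltn0Sn 0); rewrite big_seq1 expr1. Qed.

Lemma Cyclotomic_prime q : prime q -> 'Phi_q = \sum_(i < q) 'X^i.
Proof.
move=> pq; have := Cyclotomic_comp_prime (ltn0Sn 0) pq.
rewrite dvdn1 neq_ltn prime_gt1 // orbT mul1n Cyclotomic_1 => /(_ isT).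
rewrite comp_polyB comp_polyX comp_polyC subrX1 mulrC => e.
by apply/esym/(mulIf _ e)/monic_neq0/monicXsubC.
Qed.

(** * Coefficient sums and palindromic polynomials *)

Lemma poly_sumE (D : nat) (P : {poly int}) : (size P <= D)%N ->
  P = \sum_(i < D) P`_i *: 'X^i.
Proof.
move=> h; rewrite -poly_def; apply/polyP => i; rewrite coef_poly.
by case: ltnP => // Di; rewrite nth_default // (leq_trans h).
Qed.

Definition psum (D : nat) (P : {poly int}) : nat := (\sum_(i < D) absz (P`_i)%R)%N.

Definition l1 (P : {poly int}) : nat := psum (size P) P.

Lemma psum_mono D D' P : (D <= D')%N -> (psum D P <= psum D' P)%N.
Proof.
move=> h; rewrite /psum -(subnKC h) big_split_ord /=; exact: leq_addr.
Qed.

Lemma psum_le_l1 D P : (psum D P <= l1 P)%N.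
Proof.
have [h|h] := leqP D (size P); first exact: psum_mono.
rewrite /l1 /psum -(subnKC (ltnW h)) big_split_ord /= [X in (_ + X)%N]big1 ?addn0 //.
by move=> i _; rewrite nth_default // leq_addr.
Qed.

Lemma l1E D (P : {poly int}) : (size P <= D)%N -> l1 P = psum D P.
Proof. by move=> h; apply/eqP; rewrite eqn_leq psum_le_l1 psum_mono. Qed.

Lemma abszD_le (x y : int) : (absz (x + y)%R <= absz x + absz y)%N.
Proof. lia. Qed.

Lemma absz_sum_le (I : Type) (r : seq I) (Q : pred I) (F : I -> int) :
  (absz (\sum_(i <- r | Q i) F i)%R <= \sum_(i <- r | Q i) absz (F i))%N.
Proof.
elim/big_rec2: _ => // i n x _ h.
by apply: leq_trans (abszD_le _ _) _; rewrite leq_add2l.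
Qed.

Lemma psum_eq D (P Q : {poly int}) : (forall i, (i < D)%N -> P`_i = Q`_i) -> psum D P = psum D Q.
Proof. by move=> h; apply: eq_bigr => i _; rewrite h. Qed.

Lemma psumD D P Q : (psum D (P + Q) <= psum D P + psum D Q)%N.
Proof. by rewrite /psum -big_split leq_sum // => i _; rewrite coefD abszD_le. Qed.

Lemma psumN D P : psum D (- P) = psum D P.
Proof. by apply: eq_bigr => i _; rewrite coefN abszN. Qed.

Lemma psum_sum D (I : Type) (r : seq I) (F : I -> {poly int}) :
  (psum D (\sum_(i <- r) F i)%R <= \sum_(i <- r) psum D (F i))%N.
Proof.
elim/big_rec2: _ => [|i n x _ h].
  by rewrite /psum big1 // => i _; rewrite coef0.
by apply: leq_trans (psumD _ _ _) _; rewrite leq_add2l.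
Qed.

Lemma psumMXn D c n P : (psum D (c *: (P * 'X^n)) <= absz c * psum D P)%N.
Proof.
rewrite /psum big_distrr /=.
under eq_bigr do rewrite coefZ coefMXn abszM.
rewrite -(big_mkord xpredT (fun i => absz c * absz (if (i < n)%N then 0 else P`_(i - n))%R)%N).
rewrite -(big_mkord xpredT (fun i => absz c * absz (P`_i)%R)%N).
have [h|h] := leqP n D; last first.
  rewrite big_nat big1 // => i /andP[_ iD]; rewrite (ltn_trans iD h).
  by rewrite muln0.
rewrite (@big_cat_nat _ _ _ n) //= big_nat big1 ?add0n => [|i /andP[_ ->]]; last first.
  by rewrite muln0.
rewrite -{1}[n]add0n big_addn [leqRHS](@big_cat_nat _ _ _ (D - n)) ?leq_subr //=.
apply: leq_trans (leq_addr _ _); rewrite big_nat [leqRHS]big_nat leq_sum // => i _.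
by rewrite ltnNge leq_addl /= addnK.
Qed.

(** Only the left factor stays truncated: terms of [P] of degree at least [D] cannot reach
    coefficients below [D]. With V on the left, half of its terms can be discarded later. *)
Lemma psumM D P Q : (psum D (P * Q)%R <= psum D P * l1 Q)%N.
Proof.
rewrite {1}(poly_sumE (leqnn (size Q))) mulr_sumr.
apply: leq_trans (psum_sum _ _ _) _.
rewrite [l1 Q]/(psum _ _) /psum mulnC big_distrl leq_sum //= => i _.
by rewrite -scalerAr; apply: psumMXn.
Qed.

Lemma l1M P Q : (l1 (P * Q)%R <= l1 P * l1 Q)%N.
Proof.
apply: leq_trans (psumM _ _ _) _; rewrite leq_mul2r; apply/orP; right.
exact: psum_le_l1.
Qed.

Lemma l1_1 : l1 1 = 1%N.
Proof. by rewrite /l1 /psum size_poly1 big_ord1 coef1. Qed.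

Lemma l1_Xn n : l1 'X^n = 1%N.
Proof.
rewrite /l1 /psum size_polyXn big_ord_recr /= coefXn eqxx big1 // => i _.
by rewrite coefXn ltn_eqF.
Qed.

Lemma l1D P Q : (l1 (P + Q)%R <= l1 P + l1 Q)%N.
Proof.
apply: leq_trans (psumD _ _ _) _; apply: leq_add; exact: psum_le_l1.
Qed.

Lemma l1N P : l1 (- P) = l1 P.
Proof. by rewrite /l1 size_polyN psumN. Qed.

Lemma l1_prod (I : Type) (r : seq I) (F : I -> {poly int}) :
  (l1 (\prod_(i <- r) F i)%R <= \prod_(i <- r) l1 (F i))%N.
Proof.
elim/big_rec2: _ => [|i n x _ h]; first by rewrite l1_1.
by apply: leq_trans (l1M _ _) _; rewrite leq_mul2l h orbT.
Qed.

Lemma l1_1subXn n : (l1 (1 - 'X^n)%R <= 2)%N.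
Proof. by apply: leq_trans (l1D _ _) _; rewrite l1N l1_1 l1_Xn. Qed.

Lemma l1_comp_Xn P n : (l1 (P \Po 'X^n)%R <= l1 P)%N.
Proof.
rewrite {1}(poly_sumE (leqnn (size P))) raddf_sum /=.
rewrite /l1; apply: leq_trans (psum_sum _ _ _) _; apply: leq_sum => i _.
rewrite comp_polyZ comp_Xn_poly -exprM -[X in psum _ (_ *: X)]mul1r.
apply: leq_trans (psumMXn _ _ _ _) _; rewrite -[leqRHS]muln1 leq_mul2l.
by rewrite -{1}l1_1 psum_le_l1 orbT.
Qed.

Lemma absz_coefM_le B (P Q : {poly int}) n : (forall i, absz (P`_i)%R <= B)%N ->
  (absz ((P * Q)`_n)%R <= B * l1 Q)%N.
Proof.
move=> h; rewrite coefMr; apply: leq_trans (absz_sum_le _ _ _) _.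
apply: leq_trans (_ : B * psum n.+1 Q <= _)%N; last first.
  by rewrite leq_mul2l psum_le_l1 orbT.
rewrite /psum big_distrr leq_sum //= => i _.
by rewrite abszM leq_mul2r h orbT.
Qed.

Lemma coef_mul_prod_1subXn (I : eqType) (r : seq I) (e : I -> nat) (P : {poly int}) t :
  (forall i, i \in r -> t < e i)%N ->
  (P * \prod_(i <- r) (1 - 'X^(e i)))`_t = P`_t.
Proof.
elim: r P => [|i r IH] P h; first by rewrite big_nil mulr1.
rewrite big_cons mulrA IH => [|j jr]; last by rewrite h // inE jr orbT.
by rewrite mulrBr mulr1 coefB coefMXn h ?mem_head // subr0.
Qed.

(** The reciprocal polynomial X^d P(1/X) when [P] has degree at most [d]. The formal degree is an
    argument so that [revp] is multiplicative, with degrees adding. *)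
Definition revp (d : nat) (P : {poly int}) : {poly int} :=
  \poly_(i < d.+1) P`_(d - i).

Lemma revpE d P : revp d P = \sum_(i < d.+1) P`_i *: 'X^(d - i).
Proof.
rewrite /revp poly_def (reindex_inj rev_ord_inj) /=; apply: eq_bigr => i _.
by rewrite subSS subKn // -ltnS.
Qed.

Lemma revpM d e (P Q : {poly int}) : (size P <= d.+1)%N -> (size Q <= e.+1)%N ->
  revp (d + e) (P * Q) = revp d P * revp e Q.
Proof.
move=> sP sQ; rewrite [revp d P]revpE [revp e Q]revpE {1}/revp.
rewrite {1}(poly_sumE sP) {1}(poly_sumE sQ).
rewrite !big_distrlr !pair_big /=; apply/polyP => t; rewrite coef_poly !coef_sum.
have coefE (i j i' j' : nat) u : (P`_i *: 'X^i' * (Q`_j *: 'X^j'))`_u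
    = P`_i * (Q`_j * (u == i' + j')%N%:R).
  by rewrite -!scalerAl -!scalerAr -!exprD !coefZ !coefXn.
case: ltnP => [tde|tde].
  apply: eq_bigr => -[i j] _ /=; rewrite !coefE.
  by congr (_ * (_ * (nat_of_bool _)%:R)); have := ltn_ord i; have := ltn_ord j; lia.
rewrite big1 // => -[i j] _ /=; rewrite coefE (_ : (t == _)%N = false) ?mulr0 //.
by have := ltn_ord i; have := ltn_ord j; lia.
Qed.

Lemma revp_size d P : (size (revp d P) <= d.+1)%N.
Proof. exact: size_poly. Qed.

Definition palindromic (d : nat) (P : {poly int}) : Prop := revp d P = P.

Lemma palindromic_size d (P : {poly int}) : palindromic d P -> (size P <= d.+1)%N.
Proof. by move<-; apply: revp_size. Qed.

Lemma palindromic_coef d (P : {poly int}) i :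
  palindromic d P -> (i <= d)%N -> P`_(d - i) = P`_i.
Proof. by move=> pP id; rewrite -[in RHS]pP coef_poly ltnS id. Qed.

Lemma palindromicM d e (P Q : {poly int}) :
  palindromic d P -> palindromic e Q -> palindromic (d + e) (P * Q).
Proof.
move=> pP pQ; rewrite /palindromic revpM ?palindromic_size //.
by rewrite pP pQ.
Qed.

Lemma palindromic_divl d e (P Q : {poly int}) : P != 0 -> (size Q <= e.+1)%N ->
  palindromic d P -> palindromic (d + e) (P * Q) -> palindromic e Q.
Proof.
move=> P0 sQ pP; rewrite /palindromic (revpM (palindromic_size pP) sQ) pP.
exact: mulfI.
Qed.

Lemma palindromic1 : palindromic 0 1.
Proof. by rewrite /palindromic /revp poly_def big_ord1 coef1 scale1r. Qed.

Lemma palindromic_prod (I : Type) (r : seq I) (d : I -> nat) (F : I -> {poly int}) :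
  (forall i, palindromic (d i) (F i)) ->
  palindromic (\sum_(i <- r) d i) (\prod_(i <- r) F i).
Proof.
move=> h; elim: r => [|i r IH]; rewrite ?big_nil ?big_cons; first exact: palindromic1.
exact: palindromicM.
Qed.

Lemma palindromic_comp_Xn d q (P : {poly int}) : (0 < q)%N ->
  palindromic d P -> palindromic (d * q) (P \Po 'X^q).
Proof.
move=> q0 pP; apply/polyP => i; rewrite coef_poly !coef_comp_poly_Xn // ltnS.
case: leqP => [h|h].
  rewrite dvdn_subr ?dvdn_mull //.
  case: ifP => // /dvdnP[j e]; move: h; rewrite e leq_mul2r -mulnBl !mulnK //.
  by rewrite eqn0Ngt q0 /=; apply: palindromic_coef.
case: ifP => // /dvdnP[j e]; move: h; rewrite e ltn_mul2r mulnK // q0 /= => h.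
by rewrite nth_default // (leq_trans (palindromic_size pP)).
Qed.

Definition geom (q e : nat) : {poly int} := \sum_(a < q) 'X^(a * e).

Lemma geomE q e : geom q e * (1 - 'X^e) = 1 - 'X^(q * e).
Proof.
rewrite mulrC -(opprB 'X^e) -(opprB 'X^(q * e)) mulNr; congr (- _).
rewrite mulnC exprM [RHS]subrX1; congr (_ * _); apply: eq_bigr => i _.
by rewrite -exprM mulnC.
Qed.

Lemma geom_comp q e r : geom q e \Po 'X^r = geom q (e * r).
Proof.
rewrite raddf_sum /=; apply: eq_bigr => i _.
by rewrite comp_Xn_poly -exprM mulnC mulnA.
Qed.

Lemma geom_palindromic q e : palindromic (q * e) (geom q.+1 e).
Proof.
apply/polyP => t; rewrite coef_poly ltnS /geom !coef_sum (reindex_inj rev_ord_inj) /=.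
case: leqP => h.
  apply: eq_bigr => i _; rewrite !coefXn; congr (nat_of_bool _)%:R.
  have := ltn_ord i; rewrite ltnS => iq.
  by rewrite subSS mulnBl; have := leq_mul iq (leqnn e); lia.
rewrite big1 // => i _; rewrite coefXn.
have := ltn_ord i; rewrite ltnS => iq; have := leq_mul iq (leqnn e).
by case: eqP => //; lia.
Qed.

Lemma l1_geom q e : (l1 (geom q e) <= q)%N.
Proof.
apply: leq_trans (psum_sum _ _ _) _; rewrite -[leqRHS]card_ord -sum1_card.
by apply: leq_sum => i _; rewrite -(l1_Xn (i * e)) psum_le_l1.
Qed.

(** The lowest [D] coefficients are mirrored by the highest [D], and the two blocks are disjoint. *)
Lemma palindromic_psum_half d D P : palindromic d P -> (D.*2 <= d.+1)%N ->
  (2 * psum D P <= l1 P)%N.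
Proof.
move=> pP h; rewrite (l1E (palindromic_size pP)).
have Dd : (D <= d.+1)%N by lia.
have -> : d.+1 = (D + (d.+1 - D.*2) + D)%N by lia.
rewrite {2}/psum !big_split_ord /= -/(psum D P).
rewrite [X in (_ <= _ + X)%N](_ : _ = psum D P); first by lia.
rewrite /psum (reindex_inj rev_ord_inj) /=; apply: eq_bigr => i _.
have iD := ltn_ord i.
rewrite -(palindromic_coef pP (i := (i : nat))); last by lia.
by congr (absz _`_ _); lia.
Qed.

Lemma palindromic_l1_le d P : palindromic d P -> (l1 P <= 2 * psum (d./2).+1 P)%N.
Proof.
move=> pP; rewrite (l1E (palindromic_size pP)).
set D := (d./2).+1.
have dD : (d.+1 <= D + D)%N by rewrite /D; have := odd_double_half d; lia.
have Dd : (D <= d.+1)%N by rewrite /D; have := odd_double_half d; lia.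
have -> : d.+1 = (D + (d.+1 - D))%N by lia.
rewrite {1}/psum big_split_ord /= -/(psum D P) mul2n -addnn leq_add2l.
apply: leq_trans (psum_mono _ (_ : d.+1 - D <= D)%N); last by lia.
rewrite /psum (reindex_inj rev_ord_inj) /= leq_sum // => i _.
have iD := ltn_ord i.
rewrite -(palindromic_coef pP (i := (i : nat))); last by lia.
by apply: eq_leq; congr (absz _`_ _); lia.
Qed.

(** * Products of increasing odd primes and the factorization of ['Phi_n] *)

Lemma totient_le n : (totient n <= n)%N.
Proof.
rewrite totient_count_coprime -[leqRHS]subn0 -[leqRHS]muln1 -sum_nat_const_nat.
by apply: leq_sum => i _; apply: leq_b1.
Qed.

Lemma odd_primes_incrW k p : odd_primes_incr k.+1 p -> odd_primes_incr k p.
Proof.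
by move=> [h1 h2]; split=> i hi; [apply: h1 | apply: h2]; lia.
Qed.

Lemma odd_primes_incr_prime k p i : odd_primes_incr k p -> (0 < i <= k)%N -> prime (p i).
Proof. by move=> [h _] /h /andP[]. Qed.

Lemma odd_primes_incr_odd k p i : odd_primes_incr k p -> (0 < i <= k)%N -> odd (p i).
Proof. by move=> [h _] /h /andP[]. Qed.

Lemma odd_primes_incr_ge3 k p i : odd_primes_incr k p -> (0 < i <= k)%N -> (2 < p i)%N.
Proof.
move=> h hi; apply: odd_prime_gt2; first exact: odd_primes_incr_odd hi.
exact: odd_primes_incr_prime hi.
Qed.

Lemma odd_primes_incr_lt k p i j :
  odd_primes_incr k p -> (0 < i < j)%N -> (j <= k)%N -> (p i < p j)%N.
Proof.
move=> [_ h]; elim: j => [|j IH]; first by lia.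
move=> /andP[i0]; rewrite ltnS leq_eqVlt => /orP[/eqP <-|ij] jk; first by apply: h; lia.
by apply: ltn_trans (IH _ _) (h _ _); lia.
Qed.

Lemma prod_primes_gt0 k p : odd_primes_incr k p -> (0 < prod_primes k p)%N.
Proof.
move=> h; rewrite /prod_primes big_nat prodn_cond_gt0 // => i hi.
by apply/prime_gt0/(odd_primes_incr_prime h); lia.
Qed.

Lemma dvdn_prod_primes k p i : (0 < i <= k)%N -> (p i %| prod_primes k p)%N.
Proof.
move=> hi; rewrite /prod_primes (bigD1_seq i) ?iota_uniq ?dvdn_mulr //=.
by rewrite mem_index_iota; lia.
Qed.

Lemma ndvdn_prod_primes k p : odd_primes_incr k.+1 p -> ~~ (p k.+1 %| prod_primes k p)%N.
Proof.
move=> h; have pq : prime (p k.+1) by apply: (odd_primes_incr_prime h); lia.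
rewrite /prod_primes Euclid_dvd_prod // big_has.
apply/hasPn => i; rewrite mem_index_iota => hi.
have pi : prime (p i) by apply: (odd_primes_incr_prime h); lia.
rewrite dvdn_prime2 //; apply/eqP => e.
by have := odd_primes_incr_lt (i := i) (j := k.+1) h; lia.
Qed.

Lemma Cyclotomic_prod_primesS k p : odd_primes_incr k.+1 p ->
  'Phi_(prod_primes k p) \Po 'X^(p k.+1) =
  'Phi_(prod_primes k.+1 p) * 'Phi_(prod_primes k p).
Proof.
move=> h; rewrite prod_primesS Cyclotomic_comp_prime //.
- exact/prod_primes_gt0/odd_primes_incrW.
- by apply: (odd_primes_incr_prime h); lia.
- exact: ndvdn_prod_primes.
Qed.

Lemma Cyclotomic_neq0 n : 'Phi_n != 0 :> {poly int}.
Proof. exact/monic_neq0/Cyclotomic_monic. Qed.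

Lemma prod_primes1 p : prod_primes 1 p = p 1%N.
Proof. by rewrite /prod_primes big_nat1. Qed.

(** Induction on [k]: Phi_m(X^p) = Phi_mp Phi_m is palindromic, and [palindromic_divl] removes the
    palindromic factor Phi_m. The start is k = 1, as Phi_1 = X - 1 is antipalindromic. *)
Lemma Cyclotomic_palindromic k p : (0 < k)%N -> odd_primes_incr k p ->
  palindromic (totient (prod_primes k p)) 'Phi_(prod_primes k p).
Proof.
case: k => // k _; elim: k => [|k IH] h.
  have pp : prime (p 1%N) by apply: (odd_primes_incr_prime h).
  rewrite prod_primes1 totient_prime // Cyclotomic_prime //.
  have := geom_palindromic (p 1%N).-1 1; rewrite muln1 prednK ?prime_gt0 //.
  by rewrite /geom; under eq_bigr do rewrite muln1.
have h' := odd_primes_incrW h.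
have pq : prime (p k.+2) by apply: (odd_primes_incr_prime h); lia.
apply: (palindromic_divl (Cyclotomic_neq0 (prod_primes k.+1 p)) _ (IH h')).
  by rewrite size_Cyclotomic.
rewrite mulrC -Cyclotomic_prod_primesS //.
rewrite [prod_primes k.+2 p]prod_primesS totient_coprime; last first.
  by rewrite coprime_sym prime_coprime // ndvdn_prod_primes.
rewrite (totient_prime pq) -mulnS prednK ?prime_gt0 //.
by apply: palindromic_comp_Xn; [exact: prime_gt0 | exact: IH].
Qed.

(* Epoly p j is the product of the Phi_(p_1...p_l)(X^(p_(l+2)...p_(j+1))), 1 <= l <= j;
   Gpoly p j is the factor G of the header for k = j + 1. *)
Fixpoint Epoly (p : nat -> nat) (j : nat) : {poly int} :=
  if j is j'.+1 then (Epoly p j' \Po 'X^(p j'.+2)) * 'Phi_(prod_primes j'.+1 p) else 1.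

Fixpoint Gpoly (p : nat -> nat) (j : nat) : {poly int} :=
  if j is j'.+1 then (Gpoly p j' \Po 'X^(p j'.+2)) * Epoly p j' else 1.

Lemma comp_1subXn n q : (1 - 'X^n : {poly int}) \Po 'X^q = 1 - 'X^(n * q).
Proof. by rewrite comp_polyB comp_Xn_poly -exprM comp_polyC mulnC. Qed.

(** Substituting X^q for X, with q the next prime, turns Phi_m into Phi_mq Phi_m; the extra Phi_m
    joins the product [Epoly]. *)
Lemma EpolyE j p : odd_primes_incr j.+1 p ->
  1 - 'X^(prod_primes j.+1 p) =
  (1 - 'X^(prod_primes j.+1 p %/ p 1%N)) * 'Phi_(prod_primes j.+1 p) * Epoly p j.
Proof.
elim: j => [|j IH] h.
  have pp : prime (p 1%N) by apply: (odd_primes_incr_prime h).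
  rewrite prod_primes1 divnn prime_gt0 // mulr1 Cyclotomic_prime //.
  by rewrite -opprB subrX1 -mulNr opprB.
have e := congr1 (fun P => P \Po 'X^(p j.+2)) (IH (odd_primes_incrW h)).
move: e; rewrite /= !rmorphM /= !comp_1subXn Cyclotomic_prod_primesS // -prod_primesS => ->.
rewrite divn_mulAC ?dvdn_prod_primes // -prod_primesS.
ring.
Qed.

Lemma prod1subXn_comp (r : seq nat) (e : nat -> nat) q :
  (\prod_(i <- r) (1 - 'X^(e i) : {poly int})) \Po 'X^q =
  \prod_(i <- r) (1 - 'X^(e i * q)).
Proof. by rewrite rmorph_prod; apply: eq_bigr => i _; apply: comp_1subXn. Qed.

(** Substituting X^q in the identity for m = n/q turns Phi_m into Phi_n Phi_m. The new binomial 1 -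
    X^m on the left factors by [EpolyE] as (1 - X^(m/p_1)) Phi_m E, which supplies the new binomial
    on the right, the factor E of G, and the Phi_m to be matched. *)
Lemma GpolyE j p : odd_primes_incr j.+1 p ->
  'Phi_(prod_primes j.+1 p) *
    \prod_(1 <= i < j.+2) (1 - 'X^(prod_primes j.+1 p %/ p i)) =
  (1 - 'X^(prod_primes j.+1 p)) *
    (\prod_(2 <= i < j.+2) (1 - 'X^(prod_primes j.+1 p %/ (p 1%N * p i))) * Gpoly p j).
Proof.
elim: j => [|j IH] h.
  rewrite big_nat1 [\prod_(2 <= i < 2) _]big_geq // mul1r mulr1.
  by rewrite [RHS](EpolyE h) mulr1 mulrC.
have h' := odd_primes_incrW h.
have p0 i : (0 < i < j.+3)%N -> (0 < p i)%N.
  by move=> hi; apply/prime_gt0/(odd_primes_incr_prime h); lia.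
have e := congr1 (fun P => P \Po 'X^(p j.+2)) (IH h').
move: e; rewrite /= !rmorphM /= !prod1subXn_comp !comp_1subXn.
rewrite Cyclotomic_prod_primesS // -prod_primesS.
rewrite [\prod_(1 <= i < j.+3) _]big_nat_recr //= [\prod_(2 <= i < j.+3) _]big_nat_recr //=.
have -> : (prod_primes j.+2 p %/ p j.+2 = prod_primes j.+1 p)%N.
  by rewrite (prod_primesS j.+1) mulnK // p0 //; lia.
have -> : (prod_primes j.+2 p %/ (p 1 * p j.+2) = prod_primes j.+1 p %/ p 1%N)%N.
  by rewrite (prod_primesS j.+1) divnMr // p0 //; lia.
have -> : \prod_(1 <= i < j.+2) (1 - 'X^(prod_primes j.+1 p %/ p i * p j.+2)) =
          \prod_(1 <= i < j.+2) (1 - 'X^(prod_primes j.+2 p %/ p i)) :> {poly int}.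
  rewrite big_nat [RHS]big_nat; apply: eq_bigr => i hi.
  by rewrite (prod_primesS j.+1) divn_mulAC // dvdn_prod_primes.
have -> : \prod_(2 <= i < j.+2) (1 - 'X^(prod_primes j.+1 p %/ (p 1%N * p i) * p j.+2)) =
          \prod_(2 <= i < j.+2) (1 - 'X^(prod_primes j.+2 p %/ (p 1%N * p i))) :> {poly int}.
  rewrite big_nat [RHS]big_nat; apply: eq_bigr => i hi.
  rewrite (prod_primesS j.+1) divn_mulAC // Gauss_dvd ?dvdn_prod_primes //; try lia.
  have pp l : (0 < l <= j.+2)%N -> prime (p l) by apply: (odd_primes_incr_prime h).
  rewrite prime_coprime ?pp // dvdn_prime2 ?pp //; try lia.
  by have := odd_primes_incr_lt (i := 1) (j := i) h; lia.
move=> e; rewrite (EpolyE h').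
apply: (mulfI (Cyclotomic_neq0 (prod_primes j.+1 p))).
move: e; set A := \prod_(1 <= i < j.+2) _; set B := \prod_(2 <= i < j.+2) _.
set P1 := 'Phi_(_); set P2 := 'Phi_(_); set E := Epoly _ _; set x := (1 - 'X^(_ %/ _)).
set y := (1 - _); set G := Gpoly _ _ \Po _ => e.
transitivity ((P1 * P2 * A) * (x * P2 * E)); first by rewrite /P2; ring.
by rewrite e; ring.
Qed.

(** * The bounds on heights and coefficient sums *)

(* With S_l = cycS (p_1...p_l): Rnat p j = prod_(l<=j) S_l, and Qnat p j is
   Q_(j+1) = prod_(l<j) S_l^(j-l). *)
Fixpoint Rnat (p : nat -> nat) (j : nat) : nat :=
  if j is j'.+1 then (Rnat p j' * cycS (prod_primes j'.+1 p))%N else 1%N.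

Fixpoint Qnat (p : nat -> nat) (j : nat) : nat :=
  if j is j'.+1 then (Qnat p j' * Rnat p j')%N else 1%N.

Lemma l1_Epoly p j : (l1 (Epoly p j) <= Rnat p j)%N.
Proof.
elim: j => [|j IH] /=; first by rewrite l1_1.
apply: leq_trans (l1M _ _) (leq_mul _ (leqnn _)).
exact: leq_trans (l1_comp_Xn _ _) IH.
Qed.

Lemma l1_Gpoly p j : (l1 (Gpoly p j) <= Qnat p j)%N.
Proof.
elim: j => [|j IH] /=; first by rewrite l1_1.
apply: leq_trans (l1M _ _) (leq_mul _ (l1_Epoly _ _)).
exact: leq_trans (l1_comp_Xn _ _) IH.
Qed.

(** The factor V of the header: for odd [p i], [uphalf (p i)] counts the a_i with 0 <= a_i <
    p_i/2. *)
Definition Vpoly (p : nat -> nat) (k : nat) : {poly int} :=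
  \prod_(1 <= i < k.+1) geom (uphalf (p i)) (prod_primes k p %/ p i).

Lemma VpolyS p k : odd_primes_incr k.+1 p ->
  Vpoly p k.+1 = (Vpoly p k \Po 'X^(p k.+1)) * geom (uphalf (p k.+1)) (prod_primes k p).
Proof.
move=> h; rewrite /Vpoly big_nat_recr //= {2}prod_primesS mulnK; last first.
  by apply/prime_gt0/(odd_primes_incr_prime h); lia.
congr (_ * _); rewrite rmorph_prod big_nat [RHS]big_nat; apply: eq_bigr => i hi.
by rewrite /= geom_comp divn_mulAC ?dvdn_prod_primes // -prod_primesS.
Qed.

(** As [q] and [m] are coprime and [h <= q], the exponents a m with a < h are distinct modulo [q],
    while [P \Po 'X^q] has only exponents divisible by [q]. So at most one term of [geom h m]
    contributes to a given coefficient. *)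
Lemma absz_coef_comp_geom (P : {poly int}) q m h t :
  (0 < q)%N -> coprime q m -> (h <= q)%N ->
  (forall i, absz (P`_i)%R <= 1)%N ->
  (absz (((P \Po 'X^q) * geom h m)`_t)%R <= 1)%N.
Proof.
move=> q0 cqm hq hP; rewrite mulr_sumr coef_sum.
pose c (a : 'I_h) := (a * m <= t)%N && (q %| t - a * m)%N.
have cE (a : 'I_h) : ((P \Po 'X^q) * 'X^(a * m))`_t
    = if c a then P`_((t - a * m) %/ q) else 0.
  by rewrite coefMXn coef_comp_poly_Xn // /c; case: ltnP.
under eq_bigr do rewrite cE.
case: (pickP c) => [a ca|c0]; last by rewrite big1 // => a _; rewrite c0.
rewrite (bigD1 a) //= big1 ?addr0 ?ca // => b ba; case: ifP => // cb.
case/eqP: ba; apply: val_inj => /=.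
have [/andP[la da] /andP[lb db]] := (ca, cb).
have lt_absurd (x y : 'I_h) : (x < y)%N -> c x -> c y -> False.
  move=> xy /andP[lx /dvdnP[u eu]] /andP[ly /dvdnP[v ev]].
  have : (q %| (y - x) * m)%N.
    apply/dvdnP; exists (u - v)%N; rewrite !mulnBl -eu -ev; lia.
  rewrite Gauss_dvdl // => /dvdn_leq -/(_ _); rewrite subn_gt0 xy => /(_ isT).
  by have := ltn_ord y; lia.
by case: (ltngtP a b) => // ab; [case: (lt_absurd a b) | case: (lt_absurd b a)].
Qed.

Lemma absz_coef_Vpoly p k t : odd_primes_incr k p -> (absz ((Vpoly p k)`_t)%R <= 1)%N.
Proof.
elim: k t => [|k IH] t h.
  by rewrite /Vpoly big_geq // coef1; case: eqP.
have pq : prime (p k.+1) by apply: (odd_primes_incr_prime h); lia.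
rewrite VpolyS //; apply: absz_coef_comp_geom.
- exact: prime_gt0.
- by rewrite prime_coprime // ndvdn_prod_primes.
- by have := prime_gt0 pq; lia.
- by move=> i; apply/IH/odd_primes_incrW.
Qed.

Lemma l1_Vpoly p k : (l1 (Vpoly p k) <= \prod_(1 <= i < k.+1) uphalf (p i))%N.
Proof.
by apply: leq_trans (l1_prod _ _) _; apply: leq_prod => i _; apply: l1_geom.
Qed.

Definition Upoly (p : nat -> nat) (j : nat) : {poly int} :=
  \prod_(2 <= i < j.+2) (1 - 'X^(prod_primes j.+1 p %/ (p 1%N * p i))).

Lemma l1_Upoly p j : (l1 (Upoly p j) <= 2 ^ j)%N.
Proof.
apply: leq_trans (l1_prod _ _) _.
apply: (@leq_trans (\prod_(2 <= i < j.+2) 2)%N).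
  by apply: leq_prod => i _; apply: l1_1subXn.
by rewrite prod_nat_const_nat !subSS subn0.
Qed.

(** Multiplying [GpolyE] by V turns each 1 - X^(n/p_i) into 1 - X^(h n/p_i) with h = (p_i + 1)/2.
    These exponents exceed n/2 >= t, so the binomials do not affect the coefficient of X^t, and
    neither does 1 - X^n. *)
Lemma coef_Cyclotomic_low p j t : odd_primes_incr j.+1 p ->
  (t.*2 <= totient (prod_primes j.+1 p))%N ->
  ('Phi_(prod_primes j.+1 p))`_t = (Vpoly p j.+1 * (Upoly p j * Gpoly p j))`_t.
Proof.
move=> h ht; set n := prod_primes j.+1 p in ht *.
have n0 : (0 < n)%N := prod_primes_gt0 h.
have tn : (t.*2 <= n)%N := leq_trans ht (totient_le n).
have e : 'Phi_n * \prod_(1 <= i < j.+2) (1 - 'X^(uphalf (p i) * (n %/ p i)))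
   = (Vpoly p j.+1 * (Upoly p j * Gpoly p j)) * (1 - 'X^n).
  have -> : \prod_(1 <= i < j.+2) (1 - 'X^(uphalf (p i) * (n %/ p i)))
     = \prod_(1 <= i < j.+2) (1 - 'X^(n %/ p i)) * Vpoly p j.+1 :> {poly int}.
    rewrite -big_split /=; apply: eq_bigr => i _.
    by rewrite -geomE mulrC.
  by rewrite mulrA GpolyE // -/(Upoly p j) -/n; ring.
have tn' : (t < n)%N by lia.
transitivity ((Vpoly p j.+1 * (Upoly p j * Gpoly p j)) * (1 - 'X^n))`_t; last first.
  by rewrite mulrBr mulr1 coefB coefMXn tn' subr0.
rewrite -e coef_mul_prod_1subXn // => i; rewrite mem_index_iota => hi.
have pi : (2 < p i)%N by apply: (odd_primes_incr_ge3 h); lia.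
have oi : odd (p i) by apply: (odd_primes_incr_odd h); lia.
have [c ec] : exists c, n = (c * p i)%N.
  by apply/dvdnP/dvdn_prod_primes; lia.
rewrite ec mulnK; last by lia.
have c0 : (0 < c)%N by lia.
have -> : uphalf (p i) = ((p i)./2).+1 by rewrite uphalf_half oi.
have := odd_double_half (p i); rewrite oi => eh.
have : (c * p i = c + (c * (p i)./2).*2)%N by rewrite -[in LHS]eh; lia.
lia.
Qed.

Lemma cycS_l1 n : cycS n = l1 'Phi_n.
Proof. by []. Qed.

(** By symmetry only degrees up to phi(n)/2 matter; there the coefficients of V are at most 1 in
    absolute value and those of U G have absolute sum at most 2^j Q. *)
Lemma cycA_le p j : odd_primes_incr j.+1 p ->
  (cycA (prod_primes j.+1 p) <= 2 ^ j * Qnat p j)%N.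
Proof.
move=> h; have pal := Cyclotomic_palindromic (ltn0Sn j) h.
set n := prod_primes j.+1 p in pal *.
have low t : (t.*2 <= totient n)%N -> (cyc_abs_coef n t <= 2 ^ j * Qnat p j)%N.
  move=> ht; rewrite /cyc_abs_coef coef_Cyclotomic_low //.
  have hV i := absz_coef_Vpoly (k := j.+1) i h.
  apply: leq_trans (absz_coefM_le _ _ hV) _; rewrite mul1n.
  apply: leq_trans (l1M _ _) _.
  exact: leq_mul (l1_Upoly _ _) (l1_Gpoly _ _).
apply/bigmax_leqP => -[t /=]; rewrite size_Cyclotomic ltnS => tt _.
have [ht|ht] := leqP t.*2 (totient n); first exact: low.
rewrite /cyc_abs_coef -(palindromic_coef pal tt); apply: low; lia.
Qed.

(** Each factor of V has degree at least n/3, because (p_i - 1)/2 >= p_i/3. With at least four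
    factors, deg V >= 4n/3 >= n + 1, so the first [D] coefficients lie in the lower half of V. *)
Lemma Vpoly_psum p k D : (3 < k)%N -> odd_primes_incr k p ->
  (D.*2 <= totient (prod_primes k p) + 2)%N ->
  (2 * psum D (Vpoly p k) <= l1 (Vpoly p k))%N.
Proof.
move=> k3 h hD; set n := prod_primes k p.
pose d i := ((uphalf (p i)).-1 * (n %/ p i))%N.
have palV : palindromic (\sum_(1 <= i < k.+1) d i) (Vpoly p k).
  (* [palindromic_prod] asks for all indices; outside 1..k [p i] may be 0, and then the empty [geom]
     is the zero polynomial. *)
  apply: palindromic_prod => i; rewrite /d; case: (uphalf (p i)) => [|q];
    last exact: geom_palindromic.
  by rewrite /geom big_ord0 mul0n /palindromic /revp poly_def big_ord1 coef0 scale0r.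
apply: (palindromic_psum_half palV).
have n0 : (0 < n)%N := prod_primes_gt0 h.
have dn i : (0 < i < k.+1)%N -> (n <= 3 * d i)%N.
  move=> hi.
  have pi : (2 < p i)%N by apply: (odd_primes_incr_ge3 h); lia.
  have oi : odd (p i) by apply: (odd_primes_incr_odd h); lia.
  have [c ec] : exists c, n = (c * p i)%N.
    by apply/dvdnP/dvdn_prod_primes; lia.
  rewrite /d ec mulnK; last by lia.
  have -> : uphalf (p i) = ((p i)./2).+1 by rewrite uphalf_half oi.
  have := odd_double_half (p i); rewrite oi => eh.
  have e1 : (p i <= 3 * (p i)./2)%N by lia.
  by have := leq_mul (leqnn c) e1; rewrite /=; lia.
have : (k * n <= 3 * \sum_(1 <= i < k.+1) d i)%N.
  have -> : (k * n = \sum_(1 <= i < k.+1) n)%N by rewrite sum_nat_const_nat subn1.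
  rewrite big_distrr big_nat [leqRHS]big_nat; apply: leq_sum => i hi.
  exact: dn.
have := totient_le n; have := leq_mul k3 (leqnn n).
have n3 : (2 < n)%N.
  apply: leq_trans (odd_primes_incr_ge3 (i := 1) h _) (dvdn_leq n0 _); first by lia.
  by apply: dvdn_prod_primes; lia.
by move: hD; rewrite -/n; lia.
Qed.

(** Symmetry of ['Phi_n] costs a factor 2 and the halving of V gains it back, which leaves 2^j Q
    times the product of the j + 1 numbers (p_i + 1)/2. *)
Lemma cycS_le p j : (2 < j)%N -> odd_primes_incr j.+1 p ->
  (2 * cycS (prod_primes j.+1 p) <= \prod_(1 <= i < j.+2) (p i).+1 * Qnat p j)%N.
Proof.
move=> j2 h; have pal := Cyclotomic_palindromic (ltn0Sn j) h.
have -> : (\prod_(1 <= i < j.+2) (p i).+1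
    = 2 ^ j.+1 * \prod_(1 <= i < j.+2) uphalf (p i))%N.
  have -> : (2 ^ j.+1 = \prod_(1 <= i < j.+2) 2)%N.
    by rewrite prod_nat_const_nat subn1.
  rewrite -big_split big_nat [RHS]big_nat; apply: eq_bigr => i hi /=.
  have oi : odd (p i) by apply: (odd_primes_incr_odd h); lia.
  by rewrite mul2n; have := odd_double_half (p i).+1; rewrite /= oi; lia.
set n := prod_primes j.+1 p in pal *; set D := ((totient n)./2).+1.
have e : psum D 'Phi_n = psum D (Vpoly p j.+1 * (Upoly p j * Gpoly p j)).
  apply: psum_eq => t tD; apply: coef_Cyclotomic_low => //.
  by rewrite -/n; have := odd_double_half (totient n); lia.
have s1 := palindromic_l1_le pal; rewrite -/D e in s1.
have s2 := psumM D (Vpoly p j.+1) (Upoly p j * Gpoly p j).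
have s3 : (2 * psum D (Vpoly p j.+1) <= \prod_(1 <= i < j.+2) uphalf (p i))%N.
  apply: leq_trans (l1_Vpoly _ _); apply: Vpoly_psum => //.
  by rewrite -/n; have := odd_double_half (totient n); lia.
have s4 : (l1 (Upoly p j * Gpoly p j)%R <= 2 ^ j * Qnat p j)%N.
  apply: leq_trans (l1M _ _) _.
  exact: leq_mul (l1_Upoly _ _) (l1_Gpoly _ _).
rewrite cycS_l1.
have := leq_mul s3 s4; rewrite expnS.
have : (2 * l1 'Phi_n <= 2 * (2 * psum D (Vpoly p j.+1) * l1 (Upoly p j * Gpoly p j)))%N.
  by rewrite leq_mul2l /=; apply: leq_trans s1 _; rewrite -mulnA leq_mul2l.
move=> a b; apply: leq_trans a _.
by rewrite -!mulnA leq_mul2l /= (mulnCA (2 ^ j)%N) mulnA.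
Qed.

(** * Small numbers of primes *)

Lemma Cyclotomic_prime_geom q : prime q -> 'Phi_q = geom q 1.
Proof.
move=> pq; rewrite Cyclotomic_prime //; apply: eq_bigr => i _.
by rewrite muln1.
Qed.

Lemma cycS_prime q : prime q -> (cycS q <= q)%N.
Proof. by move=> pq; rewrite cycS_l1 Cyclotomic_prime_geom // l1_geom. Qed.

Lemma oneSubXn_neq0 n : (0 < n)%N -> 1 - 'X^n != 0 :> {poly int}.
Proof. by move=> n0; rewrite -opprB oppr_eq0 monic_neq0 // monicXnsubC. Qed.

(* Since [b p + (p - a) q = p q + 1], the two products are the positive and the
   negative part of Phi_pq, with [b (p - a)] and [b (p - a) - 1] terms. *)
Lemma Cyclotomic_mul_primes p q a b : prime p -> prime q -> p != q ->
  (a < p)%N -> (b * p = 1 + a * q)%N ->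
  'Phi_(p * q) = geom b p * geom (p - a) q - 'X * (geom (q - b) p * geom a q).
Proof.
move=> pp pq npq ap eb.
have p0 := prime_gt0 pp; have q0 := prime_gt0 pq.
have bq : (b <= q)%N.
  rewrite -(leq_pmul2r p0) eb mulnC.
  by have := leq_mul ap (leqnn q); lia.
have qp : ~~ (q %| p)%N by rewrite dvdn_prime2 // eq_sym.
have e1 := Cyclotomic_comp_prime p0 pq qp.
have e2 : 'Phi_p * (1 - 'X) = 1 - 'X^p.
  by rewrite Cyclotomic_prime_geom // -['X]expr1 geomE muln1 expr1.
have e3 : ('Phi_p \Po 'X^q) * (1 - 'X^q) = 1 - 'X^(p * q).
  by rewrite Cyclotomic_prime_geom // geom_comp mul1n geomE.
have nz : (1 - 'X^p) * (1 - 'X^q) != 0 :> {poly int}.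
  by rewrite mulf_neq0 // oneSubXn_neq0.
apply: (mulIf nz).
have -> : 'Phi_(p * q) * ((1 - 'X^p) * (1 - 'X^q)) = (1 - 'X) * (1 - 'X^(p * q)).
  by rewrite -e2 -e3 e1; ring.
have -> : (geom b p * geom (p - a) q - 'X * (geom (q - b) p * geom a q))
    * ((1 - 'X^p) * (1 - 'X^q))
  = (geom b p * (1 - 'X^p)) * (geom (p - a) q * (1 - 'X^q))
    - 'X * ((geom (q - b) p * (1 - 'X^p)) * (geom a q * (1 - 'X^q))) by ring.
rewrite !geomE eb.
have -> : ((p - a) * q = 1 + (q - b) * p)%N.
  rewrite !mulnBl eb [(q * p)%N]mulnC.
  by have := leq_mul ap (leqnn q); lia.
have -> : (p * q = 1 + (a * q + (q - b) * p))%N.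
  have le : (b * p <= q * p)%N by rewrite leq_mul2r bq orbT.
  by rewrite mulnBl addnA -eb subnKC // mulnC.
by rewrite !exprD expr1; ring.
Qed.

(** By [Cyclotomic_mul_primes] the sum is at most 2b(p - a) - 1. As b p and (p - a) q add up to pq +
    1, the AM-GM inequality and integrality give 4b(p - a) <= pq + 2. *)
Lemma cycS_mul_primes p q : prime p -> prime q -> p != q ->
  (2 * cycS (p * q) <= p * q)%N.
Proof.
move=> pp pq npq; have p0 := prime_gt0 pp; have q0 := prime_gt0 pq.
have [a ap] := Bezoutl q p0.
have -> : gcdn p q = 1%N by apply/eqP; rewrite -/(coprime p q) prime_coprime // dvdn_prime2.
move=> /dvdnP[b /esym eb].
have bq : (b <= q)%N.
  rewrite -(leq_pmul2r p0) eb mulnC.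
  by have := leq_mul ap (leqnn q); lia.
have S : (cycS (p * q) <= b * (p - a) + (q - b) * a)%N.
  rewrite cycS_l1 (Cyclotomic_mul_primes pp pq npq ap eb).
  apply: leq_trans (l1D _ _) _; rewrite l1N; apply: leq_add.
    by apply: leq_trans (l1M _ _) _; apply: leq_mul; apply: l1_geom.
  apply: leq_trans (l1M _ _) _; rewrite -['X]expr1 l1_Xn mul1n.
  by apply: leq_trans (l1M _ _) _; apply: leq_mul; apply: l1_geom.
apply: leq_trans (leq_mul (leqnn 2) S) _.
have [c ec] : exists c, q = (b + c)%N by exists (q - b)%N; lia.
have [m em] : exists m, p = (a + m)%N by exists (p - a)%N; lia.
rewrite [in X in (X <= _)%N]em [in X in (X <= _)%N]ec !addKn.
have e : (c * a + 1 = b * m)%N by move: eb; rewrite ec em; lia.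
have n2 : (3 < p * q)%N by apply: (leq_mul (prime_gt1 pp) (prime_gt1 pq)).
have [sq _] := nat_AGM2 (b * p) (m * q).
have e2 : (b * p + m * q = p * q + 1)%N by rewrite eb em; lia.
rewrite e2 -mulnn in sq.
have sq' : (4 * (b * m) * (p * q) <= (p * q) * (p * q + 2) + 1)%N by lia.
have le : (4 * (b * m) <= p * q + 2)%N.
  by rewrite leqNgt; apply/negP => h; have := leq_mul h (leqnn (p * q)); lia.
lia.
Qed.

(** * Exponents of the primes in M_k *)

Lemma Mk_SS j p : Mk j.+2 p = (Mk j.+1 p * \prod_(1 <= i < j.+1) p i ^ (2 ^ (j - i)))%N.
Proof.
rewrite /Mk /=; case: j => [|j]; first by rewrite !big_geq.
rewrite ![\prod_(1 <= i < j.+2) _]big_nat_recr //= mulnA -big_split /= subnn.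
congr (_ * _)%N; last by rewrite (_ : j.+3 - j.+1 - 1 = 1)%N //; lia.
rewrite big_nat [RHS]big_nat; apply: eq_bigr => i hi; rewrite -expnD.
have -> : (j.+3 - i - 1 = (j.+1 - i).+1)%N by lia.
have -> : (j.+2 - i - 1 = j.+1 - i)%N by lia.
have e0 : (0 < 2 ^ (j.+1 - i))%N by rewrite expn_gt0.
by rewrite expnS; congr (_ ^ _)%N; lia.
Qed.

(** With n_j = p_1...p_j and N_j the product of the p_i^(2^(j-i)), this is N_(j+1) = N_j n_(j+1)
    M_(j+1), and [Mk_SS] is M_(j+2) = M_(j+1) N_j. They mirror R_(j+1) = R_j S_(j+1) and Q_(j+2) =
    Q_(j+1) R_j. *)
Lemma prod_pow2S j p :
  (\prod_(1 <= i < j.+2) p i ^ (2 ^ (j.+1 - i))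
   = \prod_(1 <= i < j.+1) p i ^ (2 ^ (j - i)) * (prod_primes j.+1 p * Mk j.+1 p))%N.
Proof.
rewrite /prod_primes /Mk [in LHS]big_nat_recr //= [in X in (_ * (X * _))%N]big_nat_recr //=.
rewrite subnn expn0 expn1; case: j => [|j]; first by rewrite !big_geq //= !mul1n muln1.
rewrite ![\prod_(1 <= i < j.+2) _]big_nat_recr //= subnn subSnn expn0 expn1.
have -> : (\prod_(1 <= i < j.+1) p i ^ (2 ^ (j.+2 - i))
    = \prod_(1 <= i < j.+1) p i ^ (2 ^ (j.+1 - i)) * \prod_(1 <= i < j.+1) p i
      * \prod_(1 <= i < j.+1) p i ^ (2 ^ (j.+2 - i - 1) - 1))%N.
  rewrite -!big_split big_nat [RHS]big_nat; apply: eq_bigr => i hi /=.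
  rewrite -expnSr -expnD.
  have -> : (j.+2 - i - 1 = j.+1 - i)%N by lia.
  have -> : (j.+2 - i = (j.+1 - i).+1)%N by lia.
  have e0 : (0 < 2 ^ (j.+1 - i))%N by rewrite expn_gt0.
  by rewrite expnS; congr (_ ^ _)%N; lia.
ring.
Qed.

Lemma odd_primes_incr_ge k p i : odd_primes_incr k p -> (0 < i <= k)%N -> (i.*2 < p i)%N.
Proof.
move=> h; elim: i => // -[|i] IH hi; first exact: odd_primes_incr_ge3 hi.
have l : (p i.+1 < p i.+2)%N by apply: (odd_primes_incr_lt h); lia.
have o1 := odd_primes_incr_odd (i := i.+1) h; have o2 := odd_primes_incr_odd h hi.
have := IH ltac:(lia); have := o1 ltac:(lia).
by move: o2 l; lia.
Qed.

(** p_i >= 2i + 1 bounds the first three factors 1 + 1/p_i by 4/3, 6/5 and 8/7, whose product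
    192/105 is below 2; every later factor is at most 10/9. *)
Lemma prod_succ_le j p : odd_primes_incr j.+3 p ->
  (9 ^ j * \prod_(1 <= i < j.+4) (p i).+1 <= 2 * 10 ^ j * prod_primes j.+3 p)%N.
Proof.
elim: j => [|j IH] h.
  rewrite !expn0 !mul1n muln1 /prod_primes unlock /= !muln1.
  have := odd_primes_incr_ge (i := 1) h isT; have := odd_primes_incr_ge (i := 2) h isT.
  have := odd_primes_incr_ge (i := 3) h isT.
  move: (p 1%N) (p 2%N) (p 3%N) => x y z hz hy hx.
  have hx' : (3 * x.+1 <= 4 * x)%N by lia.
  have hy' : (5 * y.+1 <= 6 * y)%N by lia.
  have hz' : (7 * z.+1 <= 8 * z)%N by lia.
  by have := leq_mul (leq_mul hx' hy') hz'; lia.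
rewrite prod_primesS big_nat_recr //= !expnS.
have := IH (odd_primes_incrW h).
have := odd_primes_incr_ge (i := j.+4) h ltac:(lia).
move: (\prod_(1 <= i < j.+4) _)%N (prod_primes _ _) (9 ^ j)%N (10 ^ j)%N (p j.+4)
  => A B u v x hx le.
have h1 : (9 * x.+1 <= 10 * x)%N by lia.
by have := leq_mul le h1; lia.
Qed.

Lemma cycS_le_pow m p : (0 < m)%N -> odd_primes_incr m.+3 p ->
  (9 ^ m * cycS (prod_primes m.+3 p)
   <= 10 ^ m * (prod_primes m.+3 p * Qnat p m.+2))%N.
Proof.
move=> m0 h; have le1 := cycS_le (j := m.+2) ltac:(lia) h.
have := leq_mul (leqnn (9 ^ m)%N) le1.
have := leq_mul (prod_succ_le h) (leqnn (Qnat p m.+2)).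
rewrite -[(9 ^ m * (2 * _))%N]mulnCA -!mulnA => a b.
by rewrite -(leq_pmul2l (ltn0Sn 1)); apply: leq_trans b a.
Qed.

(** * The coefficient of X^7 in Phi_105 *)

Definition p357 (i : nat) : nat := nth 0%N [:: 0; 3; 5; 7]%N i.

Lemma odd_primes_p357 : odd_primes_incr 3 p357.
Proof. by split; do 4!case=> //. Qed.

Lemma prod_p357 : prod_primes 3 p357 = 105%N.
Proof. by rewrite /prod_primes unlock. Qed.

Lemma Mk_p357 : Mk 3 p357 = 3%N.
Proof. by rewrite /Mk unlock. Qed.

Lemma coef_mul_1subXn (P : {poly int}) e t :
  (P * (1 - 'X^e))`_t = P`_t - (if (t < e)%N then 0 else P`_(t - e)).
Proof. by rewrite mulrBr mulr1 coefB coefMXn. Qed.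

(** Here G is Phi_3, and [GpolyE] reduces the claim to the coefficient of X^7 in (1 + X + X^2)(1 -
    X^5)(1 - X^7): -1 from X^2 X^5 and -1 from X^7. *)
Lemma Cyclotomic_105_7 : ('Phi_105)`_7 = - 2.
Proof.
have := congr1 (fun P : {poly int} => P`_7) (GpolyE (j := 2) odd_primes_p357).
(* The binomials on the left have exponents 35, 21 and 15, all above 7. *)
rewrite prod_p357 coef_mul_prod_1subXn => [->|i]; last first.
  by rewrite mem_index_iota; do 4!case: i => [|i] //.
rewrite big_ltn // big_ltn // big_geq //.
have -> : (105 %/ (p357 1 * p357 2) = 7)%N by [].
have -> : (105 %/ (p357 1 * p357 3) = 5)%N by [].
rewrite /Gpoly /Epoly !comp_polyC !polyC1 !mul1r comp_polyC prod_primes1.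
rewrite Cyclotomic_prime_geom //.
rewrite [X in (polyseq X)`_ _ = _](_ : _ =
   geom 3 1 * (1 - 'X^5) * (1 - 'X^7) * (1 - 'X^105)); last by ring.
rewrite !coef_mul_1subXn /= /geom !coef_sum !big_ord_recl !big_ord0 /=.
by rewrite !coefXn.
Qed.

Lemma cycA_p357 : (2 <= cycA (prod_primes 3 p357))%N.
Proof.
rewrite prod_p357 /cycA.
have s7 : (7 < size ('Phi_105))%N.
  by rewrite ltnNge; apply/negP => /(nth_default 0); rewrite Cyclotomic_105_7.
apply: leq_trans (leq_bigmax (Ordinal s7)).
by rewrite /= /cyc_abs_coef Cyclotomic_105_7.
Qed.

End CyclotomicBounds.

From Stdlib Require Import Reals.
Open Scope R_scope.

Module Growth.

Import CyclotomicBounds.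
From mathcomp Require Import all_boot zify.
From Stdlib Require Import Reals Lra.
Set Implicit Arguments. Unset Strict Implicit. Unset Printing Implicit Defensive.
Local Open Scope R_scope.

(** * Growth of the bounds *)

Lemma INR_muln m n : INR (m * n)%nat = INR m * INR n.
Proof. exact: mult_INR. Qed.

Lemma INR_expn m n : INR (expn m n) = INR m ^ n.
Proof. by elim: n => [|n IH] //=; rewrite expnS INR_muln IH. Qed.

Lemma INR_leq m n : (m <= n)%nat -> INR m <= INR n.
Proof. by move/leP; apply: le_INR. Qed.

(** By [prod_pow2S] this is the product of p_1...p_l M_l over l <= j, hence the natural scale for
    [Rnat p j]. *)
Definition Npow (p : nat -> nat) (j : nat) : nat :=
  (\prod_(1 <= i < j.+1) expn (p i) (expn 2 (j - i)))%nat.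

Lemma Rnat_step p j a b :
  INR (Rnat p j) <= a * INR (Npow p j) ->
  INR (cycS (prod_primes j.+1 p)) <= b * (INR (prod_primes j.+1 p) * INR (Mk j.+1 p)) ->
  0 <= a -> INR (Rnat p j.+1) <= a * b * INR (Npow p j.+1).
Proof.
move=> hR hS a0; rewrite /Npow prod_pow2S -/(Npow p j) /= !INR_muln.
have := Rmult_le_compat _ _ _ _ (pos_INR _) (pos_INR _) hR hS; lra.
Qed.

Lemma Qnat_step p j a c :
  INR (Rnat p j) <= a * INR (Npow p j) ->
  INR (Qnat p j) <= c * INR (Mk j.+1 p) ->
  0 <= a -> INR (Qnat p j.+1) <= c * a * INR (Mk j.+2 p).
Proof.
move=> hR hQ a0; rewrite Mk_SS -/(Npow p j) /= !INR_muln.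
have := Rmult_le_compat _ _ _ _ (pos_INR _) (pos_INR _) hQ hR; lra.
Qed.

Lemma cycS_real m p c : (0 < m)%nat -> odd_primes_incr m.+3 p ->
  INR (Qnat p m.+2) <= c * INR (Mk m.+3 p) ->
  INR (cycS (prod_primes m.+3 p))
    <= (10 / 9) ^ m * c * (INR (prod_primes m.+3 p) * INR (Mk m.+3 p)).
Proof.
move=> m0 h hQ; have := cycS_le_pow m0 h; move: hQ.
move: (Qnat _ _) (prod_primes _ _) (cycS _) (Mk _ _) => Q n S M hQ /INR_leq.
rewrite !INR_muln !INR_expn => hS; have n0 := pos_INR n.
have e9 : INR 9 = 9 by rewrite /=; lra.
have e10 : INR 10 = 10 by rewrite /=; lra.
rewrite e9 e10 in hS.
have u0 : 0 < 9 ^ m by apply: pow_lt; lra.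
have v0 : 0 < 10 ^ m by apply: pow_lt; lra.
rewrite -[10 / 9]/(10 * / 9) Rpow_mult_distr pow_inv.
apply: (Rmult_le_reg_l (9 ^ m)) => //.
have -> : 9 ^ m * (10 ^ m * / 9 ^ m * c * (INR n * INR M)) 
  = 10 ^ m * (INR n * (c * INR M)) by field; lra.
apply: Rle_trans hS _.
by apply: Rmult_le_compat_l; [lra | apply: Rmult_le_compat_l].
Qed.

(* From [10/9] per additional prime, [prod (p_i+1) <= 2 (10/9)^(k-3) prod p_i]; the
   powers of 9/10 in the bounds on Rnat and Qnat absorb this loss, and the value at
   [i = 0] fixes the constant [25/81 = (10/9)^2 / 4]. *)
Lemma Rnat_Qnat_le (d : R) : 0 <= d ->
  (forall p, odd_primes_incr 3 p ->
    INR (cycS (prod_primes 3 p)) <= d * (INR (prod_primes 3 p) * INR (Mk 3 p))) ->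
  forall i p, odd_primes_incr i.+4 p ->
  INR (Rnat p i.+4) <= (25 / 81 * d) ^ (expn 2 i) * (9 / 10) * INR (Npow p i.+4) /\
  INR (Qnat p i.+4) <= (25 / 81 * d) ^ (expn 2 i) * (9 / 10) ^ i.+2 * INR (Mk i.+4.+1 p).
Proof.
move=> d_ge0 cycS3 i p; set K := 25 / 81 * d.
have K0 : 0 <= K by rewrite /K; lra.
elim: i => [|i IH] h.
  have h3 := odd_primes_incrW h; have h2 := odd_primes_incrW h3.
  have pr l : (0 < l <= 4)%nat -> prime (p l) by apply: (odd_primes_incr_prime h).
  (* The constants obtained are 1, 1, 1/2, d/2, 5d/18 in [R0] to [R4] and 1, 1, 1, 1/2, d/4 in [Q0]
     to [Q4]. Here 5d/18 = (25d/81)(9/10) and d/4 = (25d/81)(9/10)^2. *)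
  have R0 : INR (Rnat p 0) <= 1 * INR (Npow p 0) by rewrite /Npow big_geq //=; lra.
  have Q0 : INR (Qnat p 0) <= 1 * INR (Mk 1 p) by rewrite /Mk big_geq //=; lra.
  have Q1 := Qnat_step R0 Q0 ltac:(lra).
  have S1 : INR (cycS (prod_primes 1 p)) <= 1 * (INR (prod_primes 1 p) * INR (Mk 1 p)).
    rewrite /Mk big_geq // prod_primes1 Rmult_1_r Rmult_1_l.
    exact/INR_leq/cycS_prime/pr.
  have R1 := Rnat_step R0 S1 ltac:(lra).
  have Q2 := Qnat_step R1 Q1 ltac:(lra).
  have S2 : INR (cycS (prod_primes 2 p))
      <= 1 / 2 * (INR (prod_primes 2 p) * INR (Mk 2 p)).
    rewrite /Mk big_geq // prod_primesS prod_primes1 Rmult_1_r.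
    have ne : p 1%nat != p 2%nat.
      by have := odd_primes_incr_lt (i := 1) (j := 2) h isT isT; lia.
    have := INR_leq (cycS_mul_primes (pr 1%nat isT) (pr 2%nat isT) ne).
    rewrite INR_muln -[INR 2]/2; lra.
  have R2 := Rnat_step R1 S2 ltac:(lra).
  have Q3 := Qnat_step R2 Q2 ltac:(lra).
  have R3 := Rnat_step R2 (cycS3 _ h3) ltac:(lra).
  have S4 := cycS_real (m := 1) isT h Q3.
  have R4 := Rnat_step R3 S4 ltac:(lra).
  have Q4 := Qnat_step R3 Q3 ltac:(lra).
  rewrite -[expn 2 0]/1%nat pow_1 /K; split.
    apply: Rle_trans R4 _; apply: Req_le; rewrite /=; field.
  apply: Rle_trans Q4 _; apply: Req_le; rewrite /=; field.
have [hR hQ] := IH (odd_primes_incrW h).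
have k0 : 0 <= K ^ (expn 2 i) by apply: pow_le.
have e : K ^ (expn 2 i.+1) = K ^ (expn 2 i) * K ^ (expn 2 i).
  by rewrite expnS mul2n -addnn; apply: pow_add.
have S := cycS_real (m := i.+2) isT h hQ.
(* The loss (10/9)^(i+2) cancels the factor (9/10)^(i+2) of [hQ], so S_(i+5) gets the constant
   K^(2^i). The 9/10 in [hR] provides the new factor for [Qnat]. *)
have e1 : (10 / 9) ^ i.+2 * (K ^ (expn 2 i) * (9 / 10) ^ i.+2) = K ^ (expn 2 i).
  rewrite Rmult_comm Rmult_assoc -Rpow_mult_distr.
  have -> : 9 / 10 * (10 / 9) = 1 by field.
  by rewrite pow1 Rmult_1_r.
rewrite e1 in S; split.
  apply: Rle_trans (Rnat_step hR S _) _; first by lra.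
  by rewrite e; apply: Req_le; ring.
apply: Rle_trans (Qnat_step hR hQ _) _; first by lra.
by rewrite e; apply: Req_le; rewrite /=; ring.
Qed.

Lemma cycA_growth (d : R) : 0 <= d ->
  (forall p, odd_primes_incr 3 p ->
    INR (cycS (prod_primes 3 p)) <= d * (INR (prod_primes 3 p) * INR (Mk 3 p))) ->
  forall i p, odd_primes_incr i.+4.+1 p ->
  INR (cycA (prod_primes i.+4.+1 p)) <= 2 ^ i.+4 * (25 / 81 * d) ^ (expn 2 i) * INR (Mk i.+4.+1 p).
Proof.
move=> d_ge0 cycS3 i p h; have [_ hQ] := Rnat_Qnat_le d_ge0 cycS3 (odd_primes_incrW h).
apply: Rle_trans (INR_leq (cycA_le h)) _; rewrite INR_muln INR_expn -[INR 2]/2.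
rewrite Rmult_assoc; apply: Rmult_le_compat_l; first by apply: pow_le; lra.
apply: Rle_trans hQ _; apply: Rmult_le_compat_r; first exact: pos_INR.
rewrite -[X in _ <= X]Rmult_1_r; apply: Rmult_le_compat_l.
  by apply: pow_le; lra.
rewrite -(pow1 i.+2); apply: pow_incr; lra.
Qed.

(** * The constants d, epsilon_3, rho and C *)

Lemma cycA_le_cycS n : (cycA n <= cycS n)%nat.
Proof.
apply/bigmax_leqP => i _; rewrite /cycS (bigD1 i) //=; exact: leq_addr.
Qed.

Lemma d_gt0 d : is_d d -> 0 < d.
Proof.
move=> [ub _].
have x_le := ub (INR (cycS (3 * 5 * 7)%nat) / INR (Nat.pow 3 2 * 5 * 7)%nat) _.
apply: Rlt_le_trans (x_le _); last by exists 3%nat, 5%nat, 7%nat.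
apply: Rdiv_lt_0_compat; last by apply: lt_0_INR; apply/ltP.
apply: lt_0_INR; apply/ltP; apply: leq_trans (cycA_le_cycS _).
by have := cycA_p357; rewrite prod_p357 => /ltnW.
Qed.

(** Since M_3 = p_1, the scale p_1 p_2 p_3 M_3 is the denominator p^2 q r in the definition of d. *)
Lemma cycS3_le d p : is_d d -> odd_primes_incr 3 p ->
  INR (cycS (prod_primes 3 p)) <= d * (INR (prod_primes 3 p) * INR (Mk 3 p)).
Proof.
move=> [ub _] h.
have pr i : (0 < i <= 3)%nat -> prime (p i) by apply: (odd_primes_incr_prime h).
have od i : (0 < i <= 3)%nat -> odd (p i) by apply: (odd_primes_incr_odd h).
have e : prod_primes 3 p = (p 1 * p 2 * p 3)%nat by rewrite 2!prod_primesS prod_primes1.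
have eM : Mk 3 p = p 1%nat by rewrite /Mk big_nat1 expn1.
rewrite e eM.
have pos i : (0 < i <= 3)%nat -> 0 < INR (p i).
  by move=> hi; apply: lt_0_INR; apply/ltP/prime_gt0/pr.
have [[p1 p2] p3] := (pos 1%nat isT, pos 2%nat isT, pos 3%nat isT).
have D0 : 0 < INR (p 1 * p 2 * p 3)%nat * INR (p 1%nat).
  by rewrite !INR_muln; do 3!apply: Rmult_lt_0_compat => //.
have H : INR (cycS (p 1 * p 2 * p 3)%nat) / (INR (p 1 * p 2 * p 3)%nat * INR (p 1%nat)) <= d.
  apply: ub; exists (p 1%nat), (p 2%nat), (p 3%nat).
  do !split; rewrite ?pr ?od //; try by apply: (odd_primes_incr_lt h).
  by rewrite !INR_muln /=; congr (_ / _); ring.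
apply: (Rmult_le_reg_r (/ (INR (p 1 * p 2 * p 3)%nat * INR (p 1%nat)))).
  exact: Rinv_0_lt_compat.
by rewrite Rmult_assoc Rinv_r ?Rmult_1_r //; lra.
Qed.

Lemma eps3_ge e : is_eps 3 e -> 2 / 3 <= e.
Proof.
move=> [e0 [hb _]]; have := hb _ odd_primes_p357; rewrite Mk_p357.
have := INR_leq cycA_p357; rewrite /=; lra.
Qed.

Lemma ln_le x y : 0 < x -> x <= y -> ln x <= ln y.
Proof.
by move=> x0 [xy|->]; [apply/Rlt_le/ln_increasing | apply: Rle_refl].
Qed.

Lemma ln_eps_le d e i : is_d d -> is_eps i.+4.+1 e ->
  ln e <= INR i.+4 * ln 2 + INR (expn 2 i) * ln (25 / 81 * d).
Proof.
move=> hd [e0 [_ hmin]]; have d0 := d_gt0 hd.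
have K0 : 0 < 25 / 81 * d by lra.
have t0 : 0 < 2 ^ i.+4 by apply: pow_lt; lra.
have k0 : 0 < (25 / 81 * d) ^ (expn 2 i) by apply: pow_lt.
rewrite -!ln_pow -?ln_mult //; last by lra.
apply: ln_le => //; apply: hmin; first exact: Rmult_lt_0_compat.
move=> p; apply: cycA_growth => [|q]; [lra | exact: cycS3_le].
Qed.

(** Every base (2i + 5)/(2i + 6) is at least 5/6, and the exponents 1/2^i for i <= n sum to 2 -
    1/2^n. *)
Lemma rho_partial_ge n : Rpower (5 / 6) 2 <= rho_partial n.
Proof.
have l0 : ln (5 / 6) < 0 by rewrite -ln_1; apply: ln_increasing; lra.
have [pos inv] : (forall m, 0 < / 2 ^ m) /\ (forall m, / 2 ^ m.+1 = / 2 ^ m / 2).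
  split=> m; first by apply/Rinv_0_lt_compat/pow_lt; lra.
  by rewrite /= Rinv_mult; lra.
apply: (Rle_trans _ (Rpower (5 / 6) (2 - / 2 ^ n))).
  have le : 2 * ln (5 / 6) <= (2 - / 2 ^ n) * ln (5 / 6) by have := pos n; nra.
  by case: le => [lt|eq]; [apply/Rlt_le/exp_increasing | rewrite /Rpower eq; apply: Rle_refl].
elim: n => [|n IH]; first by apply: Req_le; rewrite /=; congr Rpower; field.
rewrite -[rho_partial _]/(rho_partial n *
  Rpower ((2 * INR n.+1 + 5) / (2 * INR n.+1 + 6)) (/ 2 ^ n.+1)).
have -> : 2 - / 2 ^ n.+1 = (2 - / 2 ^ n) + / 2 ^ n.+1 by rewrite inv; lra.
rewrite Rpower_plus; apply: Rmult_le_compat => //; try exact/Rlt_le/exp_pos.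
apply: Rle_Rpower_l; first exact/Rlt_le/pos.
split; first by lra.
have n0 := pos_INR n.+1; move: (INR n.+1) n0 => x x0.
apply: (Rmult_le_reg_r (2 * x + 6)); first by lra.
have -> : (2 * x + 5) / (2 * x + 6) * (2 * x + 6) = 2 * x + 5 by field; lra.
lra.
Qed.

Lemma rho_ge rho : is_rho rho -> (5 / 6) ^ 2 <= rho.
Proof.
move=> h; have -> : (5 / 6) ^ 2 = Rpower (5 / 6) 2.
  by rewrite -Rpower_pow //; lra.
have := @Rle_cv_lim (fun _ => Rpower (5 / 6) 2) rho_partial _ _ rho_partial_ge _ h.
apply; move=> e e0; exists 0%nat => n _; rewrite /Rdist Rminus_diag Rabs_R0; lra.
Qed.

(** Roots are estimated through powers: y = e3^(3/2) has y^2 >= 8/27 > 0.54^2, and z = rho^(1/4) has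
    z^4 >= 25/36 > 0.9^4. So 3/4 y z >= 0.3645, which exceeds 25/81. *)
Lemma Cconst_base_ge e3 d rho : 2 / 3 <= e3 -> 0 < d -> (5 / 6) ^ 2 <= rho ->
  25 / 81 * d <= 3 / 4 * Rpower e3 (3 / 2) * d * Rpower rho (1 / 4).
Proof.
move=> he d0 hr.
have y0 : 0 < Rpower e3 (3 / 2) by apply: exp_pos.
have z0 : 0 < Rpower rho (1 / 4) by apply: exp_pos.
have y2 : Rpower e3 (3 / 2) ^ 2 = e3 ^ 3.
  rewrite -!Rpower_pow ?Rpower_mult; [|lra|exact: y0].
  by congr Rpower; rewrite /=; field.
have z4 : Rpower rho (1 / 4) ^ 4 = rho.
  have rho0 : 0 < rho by lra.
  rewrite -Rpower_pow ?Rpower_mult; last exact: z0.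
  have -> : 1 / 4 * INR 4 = 1 by rewrite /=; field.
  exact: Rpower_1.
have e3p : (2 / 3) ^ 3 <= e3 ^ 3 by apply: pow_incr; lra.
move: (Rpower e3 _) (Rpower rho _) y0 z0 y2 z4 => y z y0 z0 y2 z4.
have y1 : 54 / 100 <= y.
  apply: Rnot_lt_le => lt; have := pow_incr y (54 / 100) 2; lra.
have z1 : 9 / 10 <= z.
  apply: Rnot_lt_le => lt; have := pow_incr z (9 / 10) 4; lra.
have yz : 54 / 100 * (9 / 10) <= y * z by apply: Rmult_le_compat; lra.
have -> : 3 / 4 * y * d * z = 3 / 4 * (y * z) * d by ring.
by apply: Rmult_le_compat_r; lra.
Qed.

Lemma ln_Cconst_ge e3 d rho : is_eps 3 e3 -> is_d d -> is_rho rho ->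
  ln (25 / 81 * d) <= 32 * ln (Cconst e3 d rho).
Proof.
move=> he hd hr; have d0 := d_gt0 hd.
have le := Cconst_base_ge (eps3_ge he) d0 (rho_ge hr).
rewrite /Cconst {3}/Rpower ln_exp; set x := _ * Rpower rho _ in le *.
have -> : 32 * (1 / 32 * ln x) = ln x by field.
apply: ln_le le; lra.
Qed.

(** * Passage to C + o(1) *)

Lemma INR_le_pow_3_2 n : INR n <= 2 * (3 / 2) ^ n.
Proof.
(* [poly] is Bernoulli's inequality, here 1 + n/2 <= (3/2)^n. *)
have := poly n (1 / 2) ltac:(lra).
have -> : 1 + 1 / 2 = 3 / 2 by field.
lra.
Qed.

Lemma exp_geom_cv C c : Un_cv (fun k => C * (exp (c * (3 / 4) ^ k) - 1)) 0.
Proof.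
have g0 : Un_cv (fun k => (3 / 4) ^ k) 0.
  move=> e e0; have [|N hN] := pow_lt_1_zero (3 / 4) _ e e0.
    by rewrite Rabs_pos_eq; lra.
  by exists N => n hn; rewrite /Rdist Rminus_0_r; apply: hN.
have ct : continuity_pt (fun x => C * (exp (c * x) - 1)) 0.
  by apply: derivable_continuous_pt; reg.
have := continuity_seq _ _ _ ct g0.
by rewrite Rmult_0_r exp_0 Rminus_diag Rmult_0_r.
Qed.

(** For k = i + 5, 2^k is 32 times 2^i, so [ln_eps_le] and [ln_Cconst_ge] leave an error of at most
    k log 2. The cases k <= 4 are absorbed by adding their deviations to [c]. *)
Lemma eps_ln_bound (eps : nat -> R) (d rho : R) :
  (forall k, le 1 k -> is_eps k (eps k)) -> is_d d -> is_rho rho ->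
  exists c, forall k, le 1 k ->
    ln (eps k) <= 2 ^ k * ln (Cconst (eps 3%nat) d rho) + c * INR k.
Proof.
move=> heps hd hr; set L := ln (Cconst _ _ _).
have hL : ln (25 / 81 * d) <= 32 * L.
  by apply: ln_Cconst_ge => //; apply: heps; apply/leP.
pose e k := Rabs (ln (eps k) - 2 ^ k * L).
have e0 k : 0 <= e k by apply: Rabs_pos.
have l2 : 0 < ln 2 by rewrite -ln_1; apply: ln_increasing; lra.
exists (ln 2 + e 1%nat + e 2%nat + e 3%nat + e 4%nat) => k /leP k1.
have small : e k <= ln 2 + e 1%nat + e 2%nat + e 3%nat + e 4%nat ->
    ln (eps k) <= 2 ^ k * L + (ln 2 + e 1%nat + e 2%nat + e 3%nat + e 4%nat) * INR k.
  move=> h; have := Rle_abs (ln (eps k) - 2 ^ k * L); rewrite -/(e k).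
  have : 1 <= INR k by apply: (INR_leq k1).
  have := e0 k; nra.
have [e1 e2 e3 e4] := And4 (e0 1%nat) (e0 2%nat) (e0 3%nat) (e0 4%nat).
case: k k1 small => [//|[|[|[|[|i]]]]] _ small; try by apply: small; lra.
clear small; have le := ln_eps_le hd (heps i.+4.+1 ltac:(apply/leP => //)).
have p2 : 0 <= INR (expn 2 i) := pos_INR _.
have pe : 2 ^ i.+4.+1 = 32 * INR (expn 2 i) by rewrite INR_expn (_ : INR 2 = 2) //=; ring.
rewrite pe; have := Rmult_le_compat_l _ _ _ p2 hL.
have : INR i.+4 * ln 2 <= (ln 2 + e 1%nat + e 2%nat + e 3%nat + e 4%nat) * INR i.+4.+1.
  rewrite (S_INR i.+4); have := pos_INR i.+4; nra.
lra.
Qed.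

End Growth.

Theorem theorem1 :
  forall (eps : nat -> R) (d rho : R),
    (forall k : nat, (1 <= k)%nat -> is_eps k (eps k)) ->
    is_d d ->
    is_rho rho ->
    exists delta : nat -> R,
      Un_cv delta 0 /\
      (forall k : nat, (1 <= k)%nat ->
         0 < Cconst (eps 3%nat) d rho + delta k /\
         ln (eps k) <= 2 ^ k * ln (Cconst (eps 3%nat) d rho + delta k)).
Proof.
intros eps d rho heps hd hr.
destruct (Growth.eps_ln_bound heps hd hr) as [c hc].
assert (C0 : 0 < Cconst (eps 3%nat) d rho) by apply exp_pos.
revert hc C0; generalize (Cconst (eps 3%nat) d rho); intros C hc C0.
(* This makes C + delta_k = C exp(2 |c| (3/4)^k), so 2^k log(C + delta_k) gains 2 |c| (3/2)^k >= |c|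
   k. A ratio between 1/2 and 1 lets delta tend to 0 while the gain outgrows k. *)
exists (fun k => C * (exp (2 * Rabs c * (3 / 4) ^ k) - 1)).
split; [apply Growth.exp_geom_cv|].
intros k hk.
replace (C + C * (exp (2 * Rabs c * (3 / 4) ^ k) - 1))
  with (C * exp (2 * Rabs c * (3 / 4) ^ k)) by ring.
assert (E0 := exp_pos (2 * Rabs c * (3 / 4) ^ k)).
split; [now apply Rmult_lt_0_compat|].
rewrite ln_mult, ln_exp; [|exact C0|exact E0].
apply Rle_trans with (1 := hc k hk).
rewrite Rmult_plus_distr_l; apply Rplus_le_compat_l.
replace (2 ^ k * (2 * Rabs c * (3 / 4) ^ k)) with (Rabs c * (2 * (3 / 2) ^ k)).
- apply Rle_trans with (Rabs c * INR k).
  + apply Rmult_le_compat_r; [apply pos_INR | apply Rle_abs].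
  + apply Rmult_le_compat_l; [apply Rabs_pos | apply Growth.INR_le_pow_3_2].
- replace (3 / 2) with (2 * (3 / 4)) by field.
  rewrite Rpow_mult_distr; ring.
Qed.
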